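(* Let $p\geq 3$ be any fixed prime integer, and let $\pi\in\mathbb{F}_p[t]$ be any fixed irreducible monic polynomial of degree $m\geq 1$. For $c\in\mathbb{F}_p[t]$ let $\varphi_{p,c}$ be the polynomial map defined by $\varphi_{p,c}(z)=z^p+c$ for all $z\in\mathbb{F}_p[t]$. Then for every $c\in\mathbb{F}_p[t]$ the number of distinct fixed points of $\varphi_{p,c}$ modulo $\pi$ is either $p$ or $0$.
   Context: The number of distinct fixed points of $\varphi_{p,c}$ modulo $\pi$ means $\#\{z\in\mathbb{F}_p[t]/(\pi) : \varphi_{p,c}(z)-z\equiv 0 \pmod{\pi}\}$. *)

(* Defs.v *)
From HB Require Import structures.
From mathcomp Require Import all_boot all_order all_algebra.
From mathcomp Require Import ring.
Set Implicit Arguments.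
Unset Strict Implicit.
Unset Printing Implicit Defensive.
Import GRing.Theory.
Local Open Scope ring_scope.

Definition phi (p : nat) (c z : {poly 'F_p}) : {poly 'F_p} := z ^+ p + c.
Arguments phi : clear implicits.

(* An element of {poly %/ pi} is stored as its reduced representative and
   coerces to {poly 'F_p}; the congruence below is evaluated at that
   representative, which is harmless by dvdp_phi_sub. The library type
   {poly %/ pi} is the quotient by pi only if pi is monic of positive degree;
   otherwise it is the quotient by 'X. *)
Definition num_fixed_points_mod (p : nat) (pi c : {poly 'F_p}) : nat :=
  #|[set z : {poly %/ pi} | pi %| phi p c (z : {poly 'F_p}) - (z : {poly 'F_p})]|.
Arguments num_fixed_points_mod : clear implicits.

Lemma dvdp_phi_sub (p : nat) (pi c z w : {poly 'F_p}) :
  pi %| z - w -> (pi %| phi p c z - z) = (pi %| phi p c w - w).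
Proof.
move=> zw; have -> : phi p c z - z = (phi p c w - w) + (z ^+ p - w ^+ p - (z - w)).
  rewrite /phi; ring.
by rewrite dvdp_addl // dvdp_sub // subrXX; exact: dvdp_mulr.
Qed.

(* Main.v *)
Require Import Defs.
From HB Require Import structures.
From mathcomp Require Import all_boot all_order all_algebra.
From mathcomp Require Import finfield ring.
Import GRing.Theory.
Local Open Scope ring_scope.

(** Write K for the field F_p[t]/(pi), of characteristic p.  The fixed points
    in K are the roots of z^p - z + c, and z |-> z^p - z is additive by
    Frobenius.  So, as soon as there is one fixed point z0, the fixed points
    are exactly the z for which w = z - z0 satisfies w^p = w in K
    ([dvdp_phi_sub_translate]).  Since X^p - X is the product of the X - a over
    all a in F_p, and K has no zero divisors, such a w is one of the p
    constants ([irreducible_dvdp_expf_card_sub]).  The set of fixed points is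
    therefore empty or the coset z0 + F_p, which has p elements. *)

(** This is the absence of zero divisors modulo an irreducible polynomial. *)
Lemma irreducible_dvdp_prod (R : idomainType) (I : finType) (q : {poly R})
    (f : I -> {poly R}) :
  irreducible_poly q -> q %| \prod_i f i -> exists i, q %| f i.
Proof.
move=> q_irr q_dvd; apply/existsP; apply: contraLR q_dvd => /existsPn q_ndvd.
rewrite -irreducible_poly_coprime //.
elim/big_ind: _ => [|g h cop_g cop_h|i _]; first exact: coprimep1.
  by rewrite coprimepMr cop_g.
by rewrite irreducible_poly_coprime.
Qed.

(** Substituting w for X in the factorisation of X^#|F| - X over F makes
    w^#|F| - w a product of translates of w by constants. *)
Lemma irreducible_dvdp_expf_card_sub (F : finFieldType) (q w : {poly F}) :
  irreducible_poly q ->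
  q %| w ^+ #|F| - w <-> exists a : F, q %| w - a%:P.
Proof.
move=> q_irr; have -> : w ^+ #|F| - w = \prod_(a : F) (w - a%:P).
  have /(congr1 (comp_poly w)) := finField_genPoly F.
  rewrite rmorphB rmorphXn rmorph_prod /= comp_polyX => ->.
  by apply: eq_bigr => a _; rewrite rmorphB /= comp_polyX comp_polyC.
split=> [/(irreducible_dvdp_prod _ _ _ _ q_irr) //|[a q_dvd]].
by rewrite (bigD1 a) //= dvdp_mulr.
Qed.

(** The additivity of z |-> z^p - z in characteristic p, in the form that
    cancels c. *)
Lemma phi_sub_translate (p : nat) (c z w : {poly 'F_p}) : prime p ->
  phi p c z - z = (phi p c w - w) + ((z - w) ^+ p - (z - w)).
Proof.
move=> p_pr; have pcharP : p \in [pchar {poly 'F_p}].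
  by rewrite pchar_poly pchar_Fp.
rewrite -[(z - w) ^+ p](pFrobenius_autE pcharP).
rewrite pFrobenius_autB_comm; last exact: mulrC.
rewrite !pFrobenius_autE /phi; ring.
Qed.

(** By additivity, two solutions of z^p - z + c = 0 modulo q differ by a
    solution of u^p = u, that is, by a constant. *)
Lemma dvdp_phi_sub_translate (p : nat) (q c z w : {poly 'F_p}) :
  prime p -> irreducible_poly q -> q %| phi p c w - w ->
  q %| phi p c z - z <-> exists a : 'F_p, q %| z - w - a%:P.
Proof.
move=> p_pr q_irr w_fix; rewrite (phi_sub_translate _ _ _ w) // dvdp_addr //.
by rewrite -irreducible_dvdp_expf_card_sub // card_Fp.
Qed.

Theorem theorem1p4 (p : nat) (hp : prime p) (hp3 : (3 <= p)%N)
    (m : nat) (hm : (1 <= m)%N)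
    (pi : {poly 'F_p}) (hpi_irr : irreducible_poly pi)
    (hpi_monic : pi \is monic) (hpi_deg : size pi = m.+1)
    (c : {poly 'F_p}) :
  num_fixed_points_mod p pi c = p \/ num_fixed_points_mod p pi c = 0%N.
Proof.
rewrite /num_fixed_points_mod; set S := [set z | _].
have [->|[z0]] := set_0Vmem S; [by right; rewrite cards0 | rewrite inE => z0_fix].
left; have small (u : {poly %/ pi}) : (size (polyn u) < size pi)%N.
  have pi_mk : size (mk_monic pi) = size pi.
    by rewrite /mk_monic hpi_deg hpi_monic ltnS hm.
  by rewrite -pi_mk size_mk_monic.
have -> : S = [set z0 + qpolyC pi a | a : 'F_p].
  apply/setP => z; rewrite inE; apply/idP/imsetP => [|[a _ ->]].
    move/(dvdp_phi_sub_translate _ _ _ _ _ hp hpi_irr z0_fix) => [a pi_dvd].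
    (* The representatives are reduced, so a congruence between them is an
       equality. *)
    exists a => //; apply/val_inj/eqP; rewrite /= -subr_eq0 opprD addrA.
    apply: contraLR pi_dvd => dif_neq0.
    have := small (z - z0 - qpolyC pi a); rewrite ltnNge.
    by apply: contra => /(dvdp_leq dif_neq0).
  apply/(dvdp_phi_sub_translate _ _ _ _ _ hp hpi_irr z0_fix); exists a.
  by rewrite /= -addrA -opprD subrr dvdp0.
rewrite card_imset ?card_Fp // => a b /addrI /(congr1 val) /=.
exact: polyC_inj.
Qed.
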